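(* For all $k,l\ge 0$, $\mathbf{SSS}(\mathbb{R}^k,\mathbb{R}^l)=C^\infty(\mathbb{R}^k,\mathbb{R}^l)$; that is, a map $\mathbb{R}^k\to\mathbb{R}^l$ is sample-smooth if and only if it is $C^\infty$. More generally, $(\mathbb{R}^l)^{\mathbb{R}^k}=C^\infty(\mathbb{R}^k,\mathbb{R}^l)$.
   Context: **Sample space.** $\Omega=[0,1]^{\mathbb{N}}$; $\mathcal{B}_\Omega$ is the universal completion of its Borel (product) $\sigma$-algebra, i.e. all universally measurable subsets; $\Omega^\Omega$ is the set of all $\mathcal{B}_\Omega$-$\mathcal{B}_\Omega$-measurable self-maps of $\Omega$. **Site.** $\Omega_n:=\mathbb{R}^n\times\Omega$, $n\ge0$. A map $g:\Omega_m\to\mathbb{R}^n$ is mixed-smooth, $g\in\mathcal{C}^\infty_{\mathrm{mix}}(\Omega_m,\mathbb{R}^n)$, if (M1) $g(-,\omega)\in C^\infty(\mathbb{R}^m,\mathbb{R}^n)$ for every $\omega$, and (M2) $g(t,-)$ is $\mathcal{B}_\Omega$-Borel measurable for every $t$. The category $\mathbb{S}$ has objects $\Omega_n$ and morphisms $\mathbb{S}(\Omega_m,\Omega_n)=\{(g,\Phi): g\in\mathcal{C}^\infty_{\mathrm{mix}}(\Omega_m,\mathbb{R}^n),\Phi\in\Omega^\Omega\}$, where $(g,\Phi)(t,\omega)=(g(t,\omega),\Phi(\omega))$. **Sample-smooth spaces.** A sample-smooth space is a set $\mathcal{X}$ with, for each $n\ge0$, a set $\mathcal{X}^{\Omega_n}$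 of maps $\Omega_n\to\mathcal{X}$ (plots) containing all constant maps and such that $p\in\mathcal{X}^{\Omega_n}$, $h\in\mathbb{S}(\Omega_m,\Omega_n)$ imply $p\circ h\in\mathcal{X}^{\Omega_m}$. A map $f:\mathcal{X}\to\mathcal{Y}$ is sample-smooth (a morphism of $\mathbf{SSS}$) if $f\circ p\in\mathcal{Y}^{\Omega_n}$ for all $n$ and $p\in\mathcal{X}^{\Omega_n}$. The admissible $n$-parameter families of $\mathcal{X}$ are $\mathcal{X}^{\mathbb{R}^n}:=\{\gamma:\mathbb{R}^n\to\mathcal{X}:\gamma\circ\mathrm{pr}_{\mathbb{R}^n}\in\mathcal{X}^{\Omega_n}\}$. The Cartesian space $\mathbb{R}^k$ is the sample-smooth space with plots $(\mathbb{R}^k)^{\Omega_n}:=\mathcal{C}^\infty_{\mathrm{mix}}(\Omega_n,\mathbb{R}^k)$. *)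

(* Defs.v *)
From HB Require Import structures.
From mathcomp Require Import all_boot all_order all_algebra.
From mathcomp Require Import all_classical all_reals all_analysis.
From mathcomp Require Import measurable_realfun.
From mathcomp Require Import lra.

Set Implicit Arguments.
Unset Strict Implicit.
Unset Printing Implicit Defensive.
Import Order.TTheory GRing.Theory Num.Theory.
Import numFieldNormedType.Exports.
Local Open Scope classical_set_scope.
Local Open Scope ring_scope.

(* f is C^(k+1) iff it is Frechet differentiable
   everywhere and its derivative is C^k.  As the domain is finite-dimensional,
   x |-> 'd f x is C^k iff all the maps x |-> 'd f x v = 'D_v f x are. *)
Fixpoint Ck (R : realType) (m : nat) (W : normedModType R) (k : nat)
    (f : 'rV[R]_m -> W) : Prop :=
  if k is k'.+1 then
    (forall x, differentiable f x) /\ (forall v, Ck k' (fun x => 'D_v f x))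
  else continuous f.

Definition Cinfty (R : realType) (m n : nat) : set ('rV[R]_m -> 'rV[R]_n) :=
  [set f | forall k, Ck k f].

Section Ck_theory.
Context {R : realType}.
Implicit Types (m n k : nat) (W : normedModType R).

Lemma Ck_continuous m W k (f : 'rV[R]_m -> W) : Ck k f -> continuous f.
Proof.
case: k => [|k]; first by [].
by case=> df _ x; exact: differentiable_continuous.
Qed.

Lemma CkW m W k (f : 'rV[R]_m -> W) : Ck k.+1 f -> Ck k f.
Proof.
elim: k W f => [|k ih] W f; first exact: Ck_continuous.
by case=> df dDf; split=> // v; apply: ih; exact: dDf.
Qed.

Lemma Ck_cst m W k (a : W) : Ck k (fun _ : 'rV[R]_m => a).
Proof.
elim: k W a => [|k ih] W a; first by move=> x; exact: cst_continuous.
split=> [x|v]; first exact: differentiable_cst.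
rewrite (_ : (fun x => 'D_v _ x) = (fun=> 0)); first exact: ih.
by apply/funext => x; rewrite derive_cst.
Qed.

Lemma CkD m W k (f g : 'rV[R]_m -> W) : Ck k f -> Ck k g -> Ck k (f + g).
Proof.
elim: k W f g => [|k ih] W f g.
  by move=> cf cg x; exact: (continuousD (cf x) (cg x)).
move=> [df cf] [dg cg]; split=> [x|v]; first exact: differentiableD.
rewrite (_ : (fun x => 'D_v _ x) = (fun x => 'D_v f x) + (fun x => 'D_v g x)).
  by apply: ih; [exact: cf|exact: cg].
by apply/funext => x; rewrite deriveD//; exact: diff_derivable.
Qed.

Lemma Ck_sum m W k n (F : 'I_n -> 'rV[R]_m -> W) :
  (forall i, Ck k (F i)) -> Ck k (\sum_(i < n) F i).
Proof.
move=> cF; elim/big_ind : _ => [|f g|i _]; first exact: Ck_cst.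
  exact: CkD.
exact: cF.
Qed.

Lemma CkM m k (f g : 'rV[R]_m -> R) : Ck k f -> Ck k g -> Ck k (f * g).
Proof.
elim: k f g => [|k ih] f g.
  by move=> cf cg x; exact: (continuousM (cf x) (cg x)).
move=> cf cg; have [df Df] := cf; have [dg Dg] := cg.
split=> [x|v]; first exact: differentiableM.
rewrite (_ : (fun x => 'D_v _ x) =
    f * (fun x => 'D_v g x) + g * (fun x => 'D_v f x)).
  by apply: CkD; apply: ih; first [exact: CkW|exact: Dg|exact: Df].
by apply/funext => x; rewrite deriveM//; exact: diff_derivable.
Qed.

Lemma Ck_coord m n k (f : 'rV[R]_m -> 'rV[R]_n) (i : 'I_n) :
  Ck k f -> Ck k (fun x => f x ord0 i).
Proof.
elim: k f => [|k ih] f.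
  move=> cf x; apply: (@continuous_comp _ _ _ f (fun u => u ord0 i)).
    exact: cf.
  exact: coord_continuous.
move=> [df cf]; split=> [x|v].
  apply: (@differentiable_comp _ _ _ _ f (fun u : 'rV[R]_n => u ord0 i)) => //.
  exact: differentiable_coord.
rewrite (_ : (fun x => 'D_v _ x) = (fun x => 'D_v f x ord0 i)).
  by apply: (ih (fun x => 'D_v f x)); exact: cf.
apply/funext => x; rewrite derive_mx ?mxE//; exact: diff_derivable.
Qed.

Lemma CkZl m W k (a : 'rV[R]_m -> R) (w : W) :
  Ck k a -> Ck k (fun x => a x *: w).
Proof.
elim: k a => [|k ih] a.
  by move=> ca x; apply: continuousZr_tmp; exact: ca.
move=> [da ca]; split=> [x|v]; first exact: differentiableZl.
rewrite (_ : (fun x => 'D_v _ x) = (fun x => 'D_v a x *: w)).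
  by apply: ih; exact: ca.
apply/funext => x; rewrite !deriveE//; last exact: differentiableZl.
by rewrite diffZl.
Qed.

Lemma Ck_coordP m n k (f : 'rV[R]_m -> 'rV[R]_n) :
  Ck k f <-> forall i, Ck k (fun x => f x ord0 i).
Proof.
split=> [cf i|cf]; first exact: Ck_coord.
rewrite (_ : f = \sum_(i < n) (fun x => f x ord0 i *: delta_mx ord0 i)).
  by apply: Ck_sum => i; exact: CkZl.
by apply/funext => x; rewrite fct_sumE -row_sum_delta.
Qed.

Lemma Ck_comp m n k (f : 'rV[R]_n -> R) (g : 'rV[R]_m -> 'rV[R]_n) :
  Ck k f -> Ck k g -> Ck k (f \o g).
Proof.
elim: k f => [|k ih] f.
  by move=> cf cg x; apply: continuous_comp; [exact: cg|exact: cf].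
move=> [df cf] cg; have [dg Dg] := cg; split=> [x|v].
  exact: differentiable_comp.
rewrite (_ : (fun x => 'D_v _ x) = \sum_(i < n) ((fun x => 'D_v g x ord0 i) *
    ((fun y => 'D_(delta_mx ord0 i) f y) \o g))).
  apply: Ck_sum => i; apply: CkM.
    by apply: (@Ck_coord _ _ _ (fun x => 'D_v g x)); exact: Dg.
  by apply: ih; [exact: cf|exact: CkW].
apply/funext => x; rewrite deriveE; last exact: differentiable_comp.
rewrite diff_comp//=; have -> : 'd g x v = 'D_v g x by rewrite deriveE.
rewrite {1}(row_sum_delta ('D_v g x)) linear_sum.
rewrite fct_sumE; apply: eq_bigr => i _.
by rewrite linearZ/= -deriveE.
Qed.

Lemma Cinfty_comp m n l (f : 'rV[R]_n -> 'rV[R]_l) (g : 'rV[R]_m -> 'rV[R]_n) :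
  Cinfty f -> Cinfty g -> Cinfty (f \o g).
Proof.
move=> sf sg k; apply/Ck_coordP => i.
apply: (@Ck_comp _ _ _ (fun y => f y ord0 i)); last exact: sg.
exact/Ck_coord/sf.
Qed.

Lemma Cinfty_cst m n (a : 'rV[R]_n) : Cinfty (fun _ : 'rV[R]_m => a).
Proof. by move=> k; exact: Ck_cst. Qed.

End Ck_theory.

Definition Omega (R : realType) : Type :=
  {ptws nat -> set_type `[(0 : R), 1]%classic}.

Fact mem0_unit_itv (R : realType) : (0 : R) \in `[(0 : R), 1]%classic.
Proof. by rewrite inE/= in_itv/= lexx ler01. Qed.

HB.instance Definition _ (R : realType) := Topological.on (Omega R).
HB.instance Definition _ (R : realType) :=
  isPointed.Build (Omega R) (fun=> exist _ 0 (mem0_unit_itv R)).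

Definition Borel (T : ptopologicalType) := g_sigma_algebraType (@open T).

Section completion.
Context d (T : measurableType d) (R : realType) (mu : {measure set T -> \bar R}).

Lemma completed_algebra_gen0 : completed_algebra_gen mu set0.
Proof.
exists set0; first exact: measurable0.
by exists set0; [exact: negligible_set0|rewrite setU0].
Qed.

Lemma completed_algebra_genC A :
  completed_algebra_gen mu A -> completed_algebra_gen mu (~` A).
Proof.
move=> [B mB [N [M [mM M0 NM]]] <-].
exists (~` (B `|` M)); first exact/measurableC/measurableU.
exists (M `\` (B `|` N)); first by exists M; split => // x [].
apply/seteqP; split=> x /=.
  by case=> [BM [Bx|Nx]|[_]//]; apply: BM; [left|right; exact: NM].
by move=> BN; case: (pselect (M x)) => Mx; [right|left => -[Bx|//]];
  [|apply: BN; left].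
Qed.

Lemma completed_algebra_gen_bigcup (F : (set T)^nat) :
  (forall i, completed_algebra_gen mu (F i)) ->
  completed_algebra_gen mu (\bigcup_i F i).
Proof.
move=> mF.
have /choice[B /choice[N BN]] : forall i, exists B, exists N,
    [/\ measurable B, mu.-negligible N & B `|` N = F i].
  by move=> i; have [B mB [N negN BN]] := mF i; exists B, N.
exists (\bigcup_i B i); first by apply: bigcup_measurable => i _; case: (BN i).
exists (\bigcup_i N i); first by apply: negligible_bigcup => i; case: (BN i).
by rewrite -bigcupU; apply: eq_bigcupr => i _; case: (BN i).
Qed.

End completion.

Definition universally_measurable (R : realType) : set (set (Omega R)) :=
  [set A | forall P : probability (Borel (Omega R)) R,
     completed_algebra_gen P A].

Section Omega_measurable.
Context {R : realType}.

Let universally_measurable0 : universally_measurable (set0 : set (Omega R)).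
Proof. by move=> P; exact: completed_algebra_gen0. Qed.

Let universally_measurableC (A : set (Omega R)) :
  universally_measurable A -> universally_measurable (~` A).
Proof. by move=> mA P; exact/completed_algebra_genC/mA. Qed.

Let universally_measurable_bigcup (F : (set (Omega R))^nat) :
  (forall i, universally_measurable (F i)) ->
  universally_measurable (\bigcup_i F i).
Proof. by move=> mF P; apply: completed_algebra_gen_bigcup => i; exact: mF. Qed.

(* From here on, measurability in Omega R itself means universal
   measurability; the Borel sets are those of Borel (Omega R). *)
HB.instance Definition _ := @isMeasurable.Build default_measure_display
  (Omega R) (@universally_measurable R) universally_measurable0
  universally_measurableC universally_measurable_bigcup.

End Omega_measurable.

Definition Omega_ (R : realType) (n : nat) : Type := ('rV[R]_n * Omega R)%type.

Definition Cmix (R : realType) (m n : nat) : set (Omega_ R m -> 'rV[R]_n) :=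
  [set g | (forall w, Cinfty (fun t => g (t, w))) /\
           (forall t, measurable_fun [set: Omega R]
                        (fun w => g (t, w) : Borel 'rV[R]_n))].

(* The morphisms Omega_m -> Omega_n of the site, as maps: (g, Phi) acts by
   (t, w) |-> (g (t, w), Phi w). *)
Definition site_hom (R : realType) (m n : nat) :
    set (Omega_ R m -> Omega_ R n) :=
  [set h | exists g (Phi : Omega R -> Omega R),
     [/\ Cmix g, measurable_fun [set: Omega R] Phi &
         h = fun x => (g x, Phi x.2)]].
Arguments site_hom : clear implicits.

Record SSSpace (R : realType) := MkSSSpace {
  carrier :> Type ;
  plot : forall n, set (Omega_ R n -> carrier) ;
  plot_cst : forall n (x : carrier), plot (fun _ : Omega_ R n => x) ;
  plot_comp : forall m n (p : Omega_ R n -> carrier) h,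
    plot p -> site_hom R m n h -> plot (p \o h) }.

Definition sample_smooth (R : realType) (X Y : SSSpace R) : set (X -> Y) :=
  [set f : X -> Y | forall n (p : Omega_ R n -> X), plot p -> plot (f \o p)].
Arguments sample_smooth {R}.

Definition admissible (R : realType) (X : SSSpace R) (n : nat) :
    set ('rV[R]_n -> X) :=
  [set gamma : 'rV[R]_n -> X | plot (gamma \o (fst : Omega_ R n -> 'rV[R]_n))].
Arguments admissible {R}.

Section cartesian.
Context {R : realType}.

Lemma Cmix_cst m n (a : 'rV[R]_n) : Cmix (fun _ : Omega_ R m => a).
Proof. by split=> [w|t]; [exact: Cinfty_cst|exact: measurable_cst]. Qed.

(* grid k (fl k u) approximates u within 1 / (k + 1). *)
Let grid m k (q : 'rV[int]_m) : 'rV[R]_m := \row_i ((q ord0 i)%:~R / k.+1%:R).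
Let fl m k (u : 'rV[R]_m) : 'rV[int]_m := \row_i Num.floor (u ord0 i * k.+1%:R).

Let grid_fl_cvg m (u : 'rV[R]_m) : (grid k (fl k u)) @[k --> \oo] --> u.
Proof.
apply/cvgrPdist_le => /= e e0; near=> k.
have ke : k.+1%:R^-1 <= e by apply: ltW; near: k; exact: (near_infty_natSinv_lt (PosNum e0)).
rewrite /Num.Def.normr/= mx_normrE (bigmax_le _ (ltW e0))// => -[i j] _ /=.
rewrite !mxE ord1; apply: le_trans ke; set x := u _ _.
have k0 : 0 < k.+1%:R :> R by rewrite ltr0n.
rewrite -[leRHS]mul1r ler_pdivlMr// -[X in _ * X]gtr0_norm// -normrM.
rewrite mulrBl divfK ?gt_eqF// ler_norml.
have := floor_le (x * k.+1%:R); have := floorD1_gt (x * k.+1%:R).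
rewrite intrD; lra.
Unshelve. all: by end_near. Qed.

Let measurable_fl m k (q : 'rV[int]_m) :
  measurable ([set u | fl k u = q] : set (Borel 'rV[R]_m)).
Proof.
pose A (i : 'I_m) : set (Borel 'rV[R]_m) :=
  [set u : 'rV[R]_m | u ord0 i < (q ord0 i + 1)%:~R / k.+1%:R] `\`
  [set u : 'rV[R]_m | u ord0 i < (q ord0 i)%:~R / k.+1%:R].
have mA i : measurable (A i).
  apply: measurableD; apply: sub_sigma_algebra;
    apply: (@open_comp _ _ (fun u : 'rV[R]_m => u ord0 i) [set x | x < _]);
    by [move=> u _; exact: coord_continuous|exact: open_lt].
suff -> : [set u : Borel 'rV[R]_m | fl k u = q] = \bigcap_(i in [set: 'I_m]) A i.
  by apply: fin_bigcap_measurable => [|i _]; [exact: finite_finset|exact: mA].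
apply/seteqP; split=> u /=.
  move=> uq i _; rewrite /A -uq /= !mxE.
  have k0 : 0 < k.+1%:R :> R by rewrite ltr0n.
  rewrite !ltr_pdivlMr//; split; first exact: floorD1_gt.
  by apply/negP; rewrite -leNgt; exact: floor_le.
move=> uq; apply/rowP => i; rewrite mxE.
have k0 : 0 < k.+1%:R :> R by rewrite ltr0n.
have [/= + /negP] := uq i I; rewrite !ltr_pdivlMr// -leNgt => uq1 uq0.
by apply/eqP; rewrite floor_eq uq0.
Qed.

Let measurable_fun_lim d (T : measurableType d) n
    (F_ : nat -> T -> Borel 'rV[R]_n) (F : T -> Borel 'rV[R]_n) :
  (forall k, measurable_fun [set: T] (F_ k)) ->
  (forall w, F_ k w @[k --> \oo] --> (F w : 'rV[R]_n)) ->
  measurable_fun [set: T] F.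
Proof.
move=> mF_ cF; apply: (@measurability _ _ _ (Borel 'rV[R]_n) setT F (@open 'rV[R]_n)) => // _ [U oU <-].
pose C j := [set x : 'rV[R]_n | ball x j.+1%:R^-1 `<=` U].
have mC j : measurable (C j : set (Borel 'rV[R]_n)).
  suff oC : open (~` C j).
    by rewrite -(setCK (C j)); apply: measurableC; exact: sub_sigma_algebra.
  rewrite (_ : ~` C j = \bigcup_(y in ~` U) ball y j.+1%:R^-1).
    by apply: bigcup_open => y _; apply: ball_open; rewrite invr_gt0.
  apply/seteqP; split=> x /=.
    by move=> /existsNP[y /not_implyP[xy Uy]]; exists y => //; exact: ball_sym.
  by move=> [y Uy yx] /(_ y) xU; apply: Uy; apply: xU; exact: ball_sym.
rewrite setTI (_ : _ @^-1` _ =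
    \bigcup_j \bigcup_N \bigcap_i (F_ (N + i)%N @^-1` C j)).
  apply: bigcup_measurable => j _; apply: bigcup_measurable => N _.
  apply: bigcapT_measurable => i.
  by rewrite -[X in measurable X]setTI; exact: mF_.
apply/seteqP; split=> w /=.
  move=> UFw; have := open_nbhs_nbhs (conj oU UFw).
  move=> /nbhs_ballP[_/posnumP[e] eU].
  have [j _ /(_ j (leqnn j)) /ltW je] := near_infty_natSinv_lt (e%:num / 2)%:pos.
  have [N _ NF] := (cvg_ballP _ _).1 (cF w) _ [gt0 of e%:num / 2].
  exists j => //; exists N => //= i _ x Fx; apply: eU.
  rewrite (splitr e%:num); apply: (ball_triangle (NF (N + i)%N (leq_addr _ _))).
  exact: le_ball Fx.
move=> [j _ [N _ FC]].
have j0 : 0 < j.+1%:R^-1 :> R by rewrite invr_gt0.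
have [M _ MF] := (cvg_ballP _ _).1 (cF w) _ j0.
by apply: (FC M I); apply: ball_sym; apply: MF => /=; exact: leq_addl.
Qed.

Let measurable_caratheodory m n (F : 'rV[R]_m -> Omega R -> 'rV[R]_n)
    (G : Omega R -> 'rV[R]_m) :
  (forall w, continuous (F ^~ w)) ->
  (forall s, measurable_fun [set: Omega R] (F s : _ -> Borel 'rV[R]_n)) ->
  measurable_fun [set: Omega R] (G : _ -> Borel 'rV[R]_m) ->
  measurable_fun [set: Omega R] ((fun w => F (G w) w) : _ -> Borel 'rV[R]_n).
Proof.
move=> cF mF mG.
apply: (@measurable_fun_lim _ _ _ (fun k w => F (grid k (fl k (G w))) w)).
  move=> k _ V mV; rewrite setTI.
  rewrite (_ : _ @^-1` V = \bigcup_(q in [set: 'rV[int]_m])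
    (G @^-1` [set u | fl k u = q] `&` F (grid k q) @^-1` V)).
    apply: countable_bigcupT_measurable => [|q]; first exact: countableP.
    apply: measurableI.
      by rewrite -[X in measurable X]setTI; apply: mG => //; exact: measurable_fl.
    by rewrite -[X in measurable X]setTI; exact: mF.
  apply/seteqP; split=> [w Vw|w [q _ [/= <- //]]].
  by exists (fl k (G w)).
move=> w; exact: (@continuous_cvg _ _ _ \oo _ (fun k => grid k (fl k (G w)))
  (F^~ w) (G w) (cF w _) (@grid_fl_cvg _ (G w))).
Qed.

Lemma Cmix_comp m n l (p : Omega_ R n -> 'rV[R]_l) h :
  Cmix p -> site_hom R m n h -> Cmix (p \o h).
Proof.
move=> [sp mp] [g [Phi [[sg mg] mPhi ->]]]; split=> [w|t].
  apply: (@Cinfty_comp _ _ _ _ (fun s => p (s, Phi w)) (fun t => g (t, w))).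
    exact: sp.
  exact: sg.
apply: (@measurable_caratheodory _ _ (fun s w => p (s, Phi w))
  (fun w => g (t, w))).
- by move=> w; exact: (Ck_continuous (k := 0) (sp (Phi w) 0)).
- move=> s; exact: (@measurableT_comp _ _ _ _ _ (Borel 'rV[R]_l)
    (fun w => p (s, w)) setT Phi (mp s) mPhi).
- exact: mg.
Qed.

Definition cartesian (k : nat) : SSSpace R := {|
  carrier := 'rV[R]_k ;
  plot := fun n => @Cmix R n k ;
  plot_cst := fun n => @Cmix_cst n k ;
  plot_comp := fun m n => @Cmix_comp m n k |}.

End cartesian.
Arguments cartesian : clear implicits.
Arguments Cinfty : clear implicits.
Arguments Cmix : clear implicits.

(* Main.v *)
Require Import Defs.
From mathcomp Require Import all_boot all_order all_algebra.
From mathcomp Require Import all_classical all_reals all_analysis.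
Import numFieldNormedType.Exports.

(** Everything about admissible families reduces to [Cmix_fst]: a function of
    the parameter alone, [f \o fst], is mixed-smooth exactly when [f] is smooth,
    because its sections in the parameter are all equal to [f] (the sample space
    has a point, so there is such a section) and its sections in the sample are
    constant, hence measurable.

    For maps between Cartesian spaces the argument is Yoneda-like.  The
    projection [fst] is itself a plot of R^k, being [id \o fst] with [id]
    smooth; a sample-smooth [f] therefore sends it to the plot [f \o fst], and
    [f] is smooth by [Cmix_fst].  Conversely a smooth [f] preserves all plots
    ([Cmix_Cinfty_comp]): smoothness in the parameter is the chain rule, and
    measurability in the sample holds because [f] is continuous, hence Borel. *)

Local Open Scope classical_set_scope.
Local Open Scope ring_scope.

Lemma Cinfty_id (R : realType) (m : nat) : Cinfty R m m id.
Proof.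
case=> [|k]; first by move=> x; exact: cvg_id.
split=> [x|v]; first exact: ex_diff.
rewrite (_ : (fun x => 'D_v id x) = (fun=> v)); first exact: Ck_cst.
by apply/funext => x; rewrite derive_id.
Qed.

Lemma continuous_measurable_Borel (S T : ptopologicalType) (f : S -> T) :
  continuous f -> measurable_fun [set: Borel S] (f : Borel S -> Borel T).
Proof.
move=> cf.
apply: (@measurability _ _ (Borel S) (Borel T) setT f (@open T)) => // _ [U oU <-].
rewrite setTI; apply: sub_sigma_algebra.
by apply: open_comp oU => x _; exact: cf.
Qed.

Lemma Cmix_Cinfty_comp (R : realType) (m n l : nat)
    (f : 'rV[R]_n -> 'rV[R]_l) (p : Omega_ R m -> 'rV[R]_n) :
  Cinfty R n l f -> Cmix R m n p -> Cmix R m l (f \o p).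
Proof.
move=> sf [sp mp]; split=> [w|t].
  exact: (@Cinfty_comp _ _ _ _ f (fun t => p (t, w)) sf (sp w)).
have mf : measurable_fun [set: Borel 'rV[R]_n] (f : _ -> Borel 'rV[R]_l).
  exact: (continuous_measurable_Borel _ _ f (Ck_continuous (sf 0%N))).
exact: (@measurableT_comp _ _ _ (Omega R) (Borel 'rV[R]_n) (Borel 'rV[R]_l)
  f setT (fun w => p (t, w)) mf (mp t)).
Qed.

Lemma Cmix_fst (R : realType) (m l : nat) (f : 'rV[R]_m -> 'rV[R]_l) :
  Cmix R m l (f \o fst) <-> Cinfty R m l f.
Proof.
split=> [[sf _]|sf]; first exact: (sf point).
by split=> [w|t]; [exact: sf|exact: (Cmix_cst m (f t)).2].
Qed.

Theorem theorem4p25 (R : realType) (k l : nat) :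
  (sample_smooth (cartesian R k) (cartesian R l)
     = Cinfty R k l :> set ('rV[R]_k -> 'rV[R]_l)) /\
  (admissible (cartesian R l) k = Cinfty R k l :> set ('rV[R]_k -> 'rV[R]_l)).
Proof.
split; apply/seteqP; split=> f.
- by move=> sf; apply/Cmix_fst/sf; exact/(Cmix_fst R k k id)/Cinfty_id.
- by move=> sf n p; exact: Cmix_Cinfty_comp.
- by move/Cmix_fst.
- by move=> sf; exact/Cmix_fst.
Qed.
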